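(* Let $(\mathcal{X},d)$ be a metric space, let $S\subseteq\mathcal{X}$ be a finite set with $|S|=n$, and let $n_0\ge 1$ be an integer with $n_0<n$. Suppose that $S$ satisfies the strong expansion rate condition with constant $\tilde c\ge 1$ (with respect to $n_0$). For $\epsilon>0$ let $$h^* = 3\log\left(\frac{e}{\epsilon}\right)+96\,\tilde c^{2}\log\left(\frac{n}{n_0}\right).$$ Then with probability at least $1-\epsilon$ (over the random choice of pivots), the comparison tree construction with input $S$ and maximum leaf size $n_0$ requires at most $n h^*$ triplet comparisons. Furthermore, for any $q\in\mathcal{X}$, with probability at least $1-\epsilon$ the nearest neighbor search algorithm on the constructed tree uses at most $h^*+n_0$ triplet comparisons to find an approximate nearest neighbor of $q$.
   Context: $\log$ is the natural logarithm; $B(x,r)$ is the closed ball in $(\mathcal{X},d)$ with center $x$ and radius $r$. A triplet comparison is a query asking, for points $x,y,z$, whether $d(x,y)\le d(x,z)$. Comparison tree construction (input: finite set $S$, maximum leaf size $n_0$). The root is $S$. A node $A$ with $|A|\le n_0$ is a leaf. A node $A$ with $|A|>n_0$ is split: an ordered pair of distinct points $x_1,x_2\in A$ (left and right pivot) is drawn uniformly at random, the left child is $\{x\in A: d(x,x_1)\le d(x,x_2)\}$ and the right child is the remaining set $\{x\in A: d(x,x_1)>d(x,x_2)\}$ (one triplet comparison per element of $A$ to be assigned, so at most $|A|$ comparisons per split); the procedure recurses on both children, with independent randomness. Nearest neighbor search for a query $q\in\mathcal{X}$. Start at the root. At a non-leaf node with pivots $x_1$ (left) and $x_2$ (right), use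 one triplet comparison to go to the left child if $d(q,x_1)\le d(q,x_2)$ and to the right child otherwise. On reaching a leaf, an exhaustive search over its elements, using at most as many triplet comparisons as the leaf has elements (hence at most $n_0$), returns an element $\hat x_q$ of the leaf that is closest to $q$ (the approximate nearest neighbor). The collection $\mathcal{C}_S$. Take the smallest collection of subsets of $S$ such that (1) $S$ belongs to it; (2) for all $x,y\in S$, the set $A=\{z\in S: d(z,x)\le d(z,y)\}$ and its complement $S\setminus A$ belong to it; (3) it is closed under pairwise intersections. Then remove all sets with at most $n_0$ elements; the result is $\mathcal{C}_S$. Strong expansion rate. $S$ satisfies the strong expansion rate condition with constant $\tilde c\ge 1$ if $|B(x,2r)\cap A|\le \tilde c\,|B(x,r)\cap A|$ for all $A\in\mathcal{C}_S$, all $x\in A$ and all $r>0$. *)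

(* Defs.v *)
From HB Require Import structures.
From mathcomp Require Import all_boot all_order all_algebra finmap.
From mathcomp Require Import all_classical all_reals all_analysis.

Set Implicit Arguments.
Unset Strict Implicit.
Unset Printing Implicit Defensive.

Import Order.TTheory GRing.Theory Num.Theory.

Local Open Scope fset_scope.
Local Open Scope ring_scope.

(* A finitely supported law is a list of (weight, outcome) pairs; an outcome
   may be listed several times, in which case its weights add up. *)
Definition law (R : realType) (T : Type) := seq (R * T).

Definition law_ret (R : realType) (T : Type) (x : T) : law R T := [:: (1, x)].

Definition law_bind (R : realType) (T U : Type) (m : law R T)
    (f : T -> law R U) : law R U :=
  flatten [seq [seq (wx.1 * vy.1, vy.2) | vy <- f wx.2] | wx <- m].

Definition law_unif (R : realType) (T : choiceType) (A : {fset T}) : law R T :=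
  [seq ((#|` A|%:R)^-1, x) | x <- enum_fset A].

Definition Prob (R : realType) (T : Type) (m : law R T) (E : pred T) : R :=
  \sum_(wx <- m | E wx.2) wx.1.

(* [Leaf A] is a leaf holding A; [Node A x1 x2 l r] is a split of A with left
   pivot x1 and right pivot x2. *)
Inductive ctree (X : choiceType) : Type :=
| Leaf of {fset X}
| Node of {fset X} & X & X & ctree X & ctree X.

Section ComparisonTree.
Variables (R : realType) (X : metricType R).
Implicit Types (A S : {fset X}) (q x : X) (t : ctree X) (p : X * X).

Definition pivots A : {fset X * X} := [fset p in A `*` A | p.1 != p.2].

Definition left_child A p : {fset X} :=
  [fset x in A | mdist x p.1 <= mdist x p.2].

Definition right_child A p : {fset X} :=
  [fset x in A | mdist x p.1 > mdist x p.2].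

(* The fuel k only serves termination: both children are proper subsets, so
   #|` A| rounds always suffice; see [tree_lawE]. *)
Fixpoint tree_law_rec (n0 k : nat) A : law R (ctree X) :=
  if k is k'.+1 then
    if (#|` A| <= n0)%N then law_ret R (Leaf A) else
    law_bind (law_unif R (pivots A)) (fun p =>
    law_bind (tree_law_rec n0 k' (left_child A p)) (fun l =>
    law_bind (tree_law_rec n0 k' (right_child A p)) (fun r =>
    law_ret R (Node A p.1 p.2 l r))))
  else law_ret R (Leaf A).

Definition tree_law (n0 : nat) A : law R (ctree X) := tree_law_rec n0 #|` A| A.

(* Splitting A is charged one triplet comparison for each of its elements,
   pivots included. *)
Fixpoint build_cost t : nat :=
  match t with
  | Leaf _ => 0%N
  | Node A _ _ l r => (#|` A| + build_cost l + build_cost r)%N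
  end.

Fixpoint reached_leaf q t : {fset X} :=
  match t with
  | Leaf A => A
  | Node _ x1 x2 l r =>
      reached_leaf q (if mdist q x1 <= mdist q x2 then l else r)
  end.

Definition nearest_in q A x : bool :=
  (x \in A) && all (fun y => mdist q x <= mdist q y) (enum_fset A).

(* [exh q A] is the element found by a search of A for q, together with the
   number of triplet comparisons used. *)
Definition exhaustive_search (exh : X -> {fset X} -> X * nat) : Prop :=
  forall q A, A != fset0 ->
    nearest_in q A (exh q A).1 /\ ((exh q A).2 <= #|` A|)%N.

Fixpoint search (exh : X -> {fset X} -> X * nat) q t : X * nat :=
  match t with
  | Leaf A => exh q A
  | Node _ x1 x2 l r =>
      let res := search exh q (if mdist q x1 <= mdist q x2 then l else r) in
      (res.1, res.2.+1)
  end.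

Inductive generated S : {fset X} -> Prop :=
| generated_full : generated S S
| generated_half x y : x \in S -> y \in S ->
    generated S [fset z in S | mdist z x <= mdist z y]
| generated_halfC x y : x \in S -> y \in S ->
    generated S (S `\` [fset z in S | mdist z x <= mdist z y])
| generated_cap A B : generated S A -> generated S B -> generated S (A `&` B).

Definition collection (n0 : nat) S A : Prop :=
  generated S A /\ (n0 < #|` A|)%N.

(* The trace on A of the closed ball B(x, r). *)
Definition ball_in A x (r : R) : {fset X} := [fset z in A | mdist x z <= r].

Definition strong_expansion (n0 : nat) S (c : R) : Prop :=
  forall A x r, collection n0 S A -> x \in A -> 0 < r ->
    #|` ball_in A x (2 * r)|%:R <= c * #|` ball_in A x r|%:R.

Definition hstar (eps c : R) (n n0 : nat) : R :=
  3 * ln (expR 1 / eps) + 96 * c ^+ 2 * ln (n%:R / n0%:R).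

End ComparisonTree.

Section LawFacts.
Variable R : realType.

Definition total (T : Type) (m : law R T) : Prop := Prob m xpredT = 1.

Lemma total_ret (T : Type) (x : T) : total (law_ret R x).
Proof. by rewrite /total /Prob /law_ret big_cons big_nil /= addr0. Qed.

Lemma law_bind_cons (T U : Type) w (x : T) m (f : T -> law R U) :
  law_bind ((w, x) :: m) f
  = [seq (w * vy.1, vy.2) | vy <- f x] ++ law_bind m f.
Proof. by []. Qed.

Lemma Prob_bind (T U : Type) (m : law R T) (f : T -> law R U) (E : pred U) :
  Prob (law_bind m f) E = \sum_(wx <- m) wx.1 * Prob (f wx.2) E.
Proof.
elim: m => [|[w x] m IH]; first by rewrite /Prob !big_nil.
rewrite law_bind_cons big_cons -IH /Prob big_cat /= big_map; congr (_ + _).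
by rewrite big_distrr.
Qed.

Lemma eq_in_law_bind (T : eqType) (U : Type) (m : law R T)
    (f g : T -> law R U) :
  (forall x, x \in [seq wx.2 | wx <- m] -> f x = g x) ->
  law_bind m f = law_bind m g.
Proof.
elim: m => [//|[w x] m IH] fg; rewrite !law_bind_cons fg ?mem_head//.
by rewrite IH// => y ym; apply: fg; rewrite inE ym orbT.
Qed.

Lemma total_bind (T : eqType) (U : Type) (m : law R T) (f : T -> law R U) :
  total m -> (forall x, x \in [seq wx.2 | wx <- m] -> total (f x)) ->
  total (law_bind m f).
Proof.
move=> m1 f1; rewrite /total Prob_bind -[RHS]m1 [RHS]/Prob.
apply: eq_big_seq => -[w x] wxm /=.
have f1x : Prob (f x) xpredT = 1 by apply: f1; apply/mapP; exists (w, x).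
by rewrite f1x mulr1.
Qed.

Lemma total_bindT (T U : Type) (m : law R T) (f : T -> law R U) :
  total m -> (forall x, total (f x)) -> total (law_bind m f).
Proof.
move=> m1 f1; rewrite /total Prob_bind -[RHS]m1 [RHS]/Prob.
apply: eq_bigr => wx _; have -> : Prob (f wx.2) xpredT = 1 by exact: f1.
by rewrite mulr1.
Qed.

Lemma outcomes_unif (T : choiceType) (A : {fset T}) :
  [seq wx.2 | wx <- law_unif R A] = enum_fset A.
Proof. by rewrite -map_comp map_id. Qed.

Lemma total_unif (T : choiceType) (A : {fset T}) :
  A != fset0 -> total (law_unif R A).
Proof.
rewrite -cardfs_gt0 => A0; rewrite /total /Prob big_map.
rewrite big_const_seq count_predT iter_addr_0 -[_ *+ _]mulr_natr mulVf//.
by rewrite pnatr_eq0 -lt0n.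
Qed.

End LawFacts.

Section TreeFacts.
Variables (R : realType) (X : metricType R).
Implicit Types (A S : {fset X}) (p : X * X).

Lemma pivotsP A p : p \in pivots A -> [/\ p.1 \in A, p.2 \in A & p.1 != p.2].
Proof. by rewrite !inE /= => /andP[/andP[? ?] ?]. Qed.

Lemma pivots_neq0 A : (1 < #|` A|)%N -> pivots A != fset0.
Proof.
move=> A1; have A0 : A != fset0 by rewrite -cardfs_gt0 (ltn_trans _ A1).
have [x xA] := fset0Pn _ A0.
have : A `\ x != fset0.
  by move: A1; rewrite (cardfsD1 x) xA add1n ltnS cardfs_gt0.
move=> /fset0Pn[y]; rewrite !inE => /andP[yx yA].
by apply/fset0Pn; exists (y, x); rewrite !inE /= xA yA yx.
Qed.

Lemma card_left_child A p : p \in pivots A ->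
  (0 < #|` left_child A p| < #|` A|)%N.
Proof.
move=> /pivotsP[p1 p2 p12]; apply/andP; split.
  rewrite cardfs_gt0; apply/fset0Pn; exists p.1.
  by rewrite !inE /= p1 mdistxx mdist_ge0.
apply: fproper_ltn_card; rewrite fproperE; apply/andP; split.
  by apply/fsubsetP => z; rewrite !inE => /andP[].
apply/negP => /fsubsetP /(_ p.2 p2).
by rewrite !inE /= p2 /= mdistxx leNgt mdist_gt0 eq_sym p12.
Qed.

Lemma card_right_child A p : p \in pivots A ->
  (0 < #|` right_child A p| < #|` A|)%N.
Proof.
move=> /pivotsP[p1 p2 p12]; apply/andP; split.
  rewrite cardfs_gt0; apply/fset0Pn; exists p.2.
  by rewrite !inE /= p2 mdistxx mdist_gt0 eq_sym.
apply: fproper_ltn_card; rewrite fproperE; apply/andP; split.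
  by apply/fsubsetP => z; rewrite !inE => /andP[].
apply/negP => /fsubsetP /(_ p.1 p1).
by rewrite !inE /= p1 /= mdistxx ltNge mdist_ge0.
Qed.

Lemma tree_law_rec_fuel n0 k k' A : (#|` A| <= k)%N -> (#|` A| <= k')%N ->
  tree_law_rec n0 k A = tree_law_rec n0 k' A.
Proof.
elim: k k' A => [|k IH] [|k'] A //=.
- by rewrite leqn0 => /eqP ->.
- by move=> _; rewrite leqn0 => /eqP ->.
move=> Ak Ak'; case: ifP => // _; apply: eq_in_law_bind => p.
rewrite outcomes_unif => pA.
have /andP[_ ll] := card_left_child pA; have /andP[_ lr] := card_right_child pA.
rewrite (IH k' (left_child A p)) ?(IH k' (right_child A p)) //.
all: by rewrite -ltnS; apply: leq_trans; eassumption.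
Qed.

Lemma tree_lawE n0 A :
  tree_law n0 A =
  if (#|` A| <= n0)%N then law_ret R (Leaf A) else
  law_bind (law_unif R (pivots A)) (fun p =>
  law_bind (tree_law n0 (left_child A p)) (fun l =>
  law_bind (tree_law n0 (right_child A p)) (fun r =>
  law_ret R (Node A p.1 p.2 l r)))).
Proof.
rewrite /tree_law; case E: #|` A| => [//|k] /=; rewrite E.
case: ifP => // _; apply: eq_in_law_bind => p; rewrite outcomes_unif => pA.
have /andP[_] := card_left_child pA; have /andP[_] := card_right_child pA.
rewrite E !ltnS => lr ll.
by rewrite (tree_law_rec_fuel n0 ll (leqnn _))
           (tree_law_rec_fuel n0 lr (leqnn _)).
Qed.

Lemma total_tree_law n0 A : (0 < n0)%N -> total (tree_law n0 A).
Proof.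
move=> n0_gt0; have [k] := ubnP #|` A|; elim: k A => // k IH A Ak.
rewrite tree_lawE; case: leqP => An0; first exact: total_ret.
apply: total_bind; first exact/total_unif/pivots_neq0/(leq_ltn_trans n0_gt0).
move=> p; rewrite outcomes_unif => pA.
have /andP[_ ll] := card_left_child pA; have /andP[_ lr] := card_right_child pA.
apply: total_bindT => [|l]; first by apply: IH; apply: leq_trans ll _.
apply: total_bindT => [|r]; first by apply: IH; apply: leq_trans lr _.
exact: total_ret.
Qed.

End TreeFacts.

(* Main.v *)
(* Let p be uniform among the ordered pivot pairs of a node A, with children L
   and R. The ball of radius d(p.1, p.2) / 4 around a pivot stays in the child
   of that pivot, so by strong expansion a child with less than |A| / (16 c^2)
   elements forces the ball of radius d(p.1, p.2) around its pivot to contain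
   at most |A| / 16 elements. Given one pivot, at most |A| / 16 choices of the
   other one achieve this, so this happens with probability at most 1/8 for each
   child. If it happens for neither child, both have at most
   exp(-1 / (16 c^2)) |A| elements. With a = 48 c^2 this gives
     E (|L|^a + |R|^a) <= exp(-1/2) |A|^a,
   and by induction on k the height of the tree of A exceeds k with probability
   at most exp(-k/2) (|A| / n0)^a. Both costs are bounded through the height. *)
Require Import Defs.
From HB Require Import structures.
From mathcomp Require Import all_boot all_order all_algebra finmap.
From mathcomp Require Import all_classical all_reals all_analysis.
From mathcomp Require Import ring lra zify.

Set Implicit Arguments.
Unset Strict Implicit.
Unset Printing Implicit Defensive.

Import Order.TTheory GRing.Theory Num.Theory.

Local Open Scope fset_scope.
Local Open Scope ring_scope.

(** * Probability bounds for finitely supported laws *)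

Section Laws.
Context {R : realType}.

(* Carries the nonnegativity of the weights, which the type [law] does not
   record. *)
Definition supported {T : Type} (P : pred T) (m : law R T) : bool :=
  all (fun wx => (0 <= wx.1) && P wx.2) m.

Lemma supported_ret (T : Type) (P : pred T) x : P x -> supported P (law_ret R x).
Proof. by move=> Px; rewrite /supported /= ler01 Px. Qed.

Lemma supported_bind (T U : Type) (P : pred T) (Q : pred U) (m : law R T) f :
  supported P m -> (forall x, P x -> supported Q (f x)) ->
  supported Q (law_bind m f).
Proof.
move=> + Qf; elim: m => [//|[w x] m IH] /= /andP[/andP[w0 Px] Pm].
rewrite law_bind_cons /supported all_cat all_map; apply/andP; split; last exact: IH.
apply: sub_all (Qf x Px) => -[v y] /= /andP[v0 ->].
by rewrite mulr_ge0.
Qed.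

Lemma supported_unif (T : choiceType) (A : {fset T}) :
  supported (mem A) (law_unif R A).
Proof.
rewrite /supported all_map; apply/allP => x xA /=.
by rewrite invr_ge0 ler0n.
Qed.

Lemma ProbE (T : Type) (m : law R T) (E : pred T) :
  Prob m E = \sum_(wx <- m) wx.1 * (E wx.2)%:R.
Proof.
rewrite /Prob big_mkcond; apply: eq_bigr => wx _.
by case: (E _); rewrite ?mulr1 ?mulr0.
Qed.

Lemma ler_sum_supported (T : Type) (P : pred T) (m : law R T) (f g : T -> R) :
  supported P m -> (forall x, P x -> f x <= g x) ->
  \sum_(wx <- m) wx.1 * f wx.2 <= \sum_(wx <- m) wx.1 * g wx.2.
Proof.
move=> + fg; elim: m => [|[w x] m IH] /=; first by rewrite !big_nil.
move=> /andP[/andP[w0 Px] Pm]; rewrite !big_cons lerD ?IH//.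
by rewrite ler_wpM2l// fg.
Qed.

Lemma Prob_ge0 (T : Type) (P : pred T) (m : law R T) (E : pred T) :
  supported P m -> 0 <= Prob m E.
Proof.
move=> Pm; rewrite ProbE.
rewrite -[leLHS](@big1_eq _ _ +%R _ m xpredT).
under [leLHS]eq_bigr => wx _ do rewrite -(mulr0 wx.1).
by apply: (ler_sum_supported Pm (f := fun=> 0) (g := fun x => (E x)%:R)).
Qed.

(** On the support the indicators of [E] and [F] add up to at least 1. This turns a bound on a bad
    event [F] into a guarantee, with [P] supplying the sure facts. *)
Lemma Prob_ge_compl (T : Type) (P : pred T) (m : law R T) (E F : pred T) :
  Defs.total m -> supported P m -> (forall x, P x -> ~~ F x -> E x) ->
  1 - Prob m F <= Prob m E.
Proof.
move=> m1 Pm FE; rewrite lerBlDr -m1 !ProbE -big_split /=.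
under [leRHS]eq_bigr do rewrite -mulrDr.
apply: (ler_sum_supported Pm (f := fun=> 1) (g := fun x => (E x)%:R + (F x)%:R)).
move=> x /FE; case: (F x) => [_|->//]; last by rewrite addr0.
by rewrite lerDr ler0n.
Qed.

Lemma sum_total (T : Type) (m : law R T) (a : R) :
  Defs.total m -> \sum_(wx <- m) wx.1 * a = a.
Proof. by move=> m1; rewrite -mulr_suml -[RHS]mul1r; congr (_ * _). Qed.

Lemma Prob_le1 (T : Type) (P : pred T) (m : law R T) (E : pred T) :
  Defs.total m -> supported P m -> Prob m E <= 1.
Proof.
move=> m1 Pm; rewrite -m1 !ProbE.
apply: (ler_sum_supported Pm (f := fun x => (E x)%:R) (g := fun=> 1)) => x _.
by rewrite lern1 leq_b1.
Qed.

(** Union bound for an outcome assembled from two draws, as a tree is from its two subtrees. *)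
Lemma Prob_bind2_le (T U V : Type) (P : pred T) (Q : pred U)
    (m1 : law R T) (m2 : law R U) (h : T -> U -> V) (E : pred V) E1 E2 :
  Defs.total m1 -> Defs.total m2 -> supported P m1 -> supported Q m2 ->
  (forall x y, E (h x y) -> E1 x || E2 y) ->
  Prob (law_bind m1 (fun x => law_bind m2 (fun y => law_ret R (h x y)))) E
  <= Prob m1 E1 + Prob m2 E2.
Proof.
move=> t1 t2 s1 s2 hE; rewrite Prob_bind.
have -> : Prob m1 E1 + Prob m2 E2 =
    \sum_(wx <- m1) wx.1 * ((E1 wx.2)%:R + Prob m2 E2).
  under eq_bigr do rewrite mulrDr.
  by rewrite big_split /= sum_total// -ProbE.
apply: (ler_sum_supported s1
  (f := fun x => Prob (law_bind m2 (fun y => law_ret R (h x y))) E)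
  (g := fun x => (E1 x)%:R + Prob m2 E2)) => x _.
rewrite Prob_bind [Prob m2 E2]ProbE.
rewrite -[X in X + _](sum_total _ t2) -big_split /=.
under [leRHS]eq_bigr do rewrite -mulrDr.
apply: (ler_sum_supported s2 (f := fun y => Prob (law_ret R (h x y)) E)
  (g := fun y => (E1 x)%:R + (E2 y)%:R)) => y _.
rewrite ProbE /law_ret big_cons big_nil /= mul1r addr0.
move: (hE x y); case: (E _) => [/(_ isT)|_]; last by rewrite addr_ge0.
by case: (E1 x) => /=; [rewrite lerDl ler0n|move=> ->; rewrite lerDr ler0n].
Qed.

End Laws.

(** * Costs bounded by the height; nodes as generated sets *)

Section Trees.
Context {R : realType} {X : metricType R}.
Implicit Types (A S : {fset X}) (q x : X) (t : ctree X) (p : X * X).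

Fixpoint height t : nat :=
  match t with
  | Leaf _ => 0%N
  | Node _ _ _ l r => (maxn (height l) (height r)).+1
  end.

(** Induction principle for random trees. Each child contains its pivot, so nonemptiness passes
    down. *)
Lemma supported_tree_law (Q : {fset X} -> pred (ctree X)) n0 A :
  (0 < n0)%N ->
  (forall A, A != fset0 -> (#|` A| <= n0)%N -> Q A (Leaf A)) ->
  (forall A p l r, (n0 < #|` A|)%N -> p \in pivots A ->
    Q (left_child A p) l -> Q (right_child A p) r ->
    Q A (Node A p.1 p.2 l r)) ->
  A != fset0 -> supported (Q A) (tree_law n0 A).
Proof.
move=> n0_gt0 Qleaf Qnode; have [k] := ubnP #|` A|; elim: k A => // k IH A Ak A0.
rewrite tree_lawE; case: leqP => An0; first exact/supported_ret/Qleaf.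
apply: supported_bind (supported_unif _) _ => p /= pA.
have /andP[l0 ll] := card_left_child pA; have /andP[r0 lr] := card_right_child pA.
apply: supported_bind (IH _ (leq_trans ll Ak) _) _; first by rewrite -cardfs_gt0.
move=> l Ql.
apply: supported_bind (IH _ (leq_trans lr Ak) _) _; first by rewrite -cardfs_gt0.
by move=> r Qr; apply/supported_ret/Qnode.
Qed.

Lemma card_children A p :
  (#|` left_child A p| + #|` right_child A p|)%N = #|` A|.
Proof.
have <- : A `\` left_child A p = right_child A p.
  by apply/fsetP => z; rewrite !inE ltNge; case: (z \in A); rewrite //= andbT.
have {1}<- : A `&` left_child A p = left_child A p.
  by apply/fsetP => z; rewrite !inE; case: (z \in A).
exact: cardfsID.
Qed.

(** The children partition their parent, so each level of the tree costs at most |A| comparisons. *)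
Lemma build_cost_le_height n0 A : (0 < n0)%N -> A != fset0 ->
  supported (fun t => (build_cost t <= #|` A| * height t)%N) (tree_law n0 A).
Proof.
move=> n0_gt0.
apply: (supported_tree_law
  (Q := fun A t => (build_cost t <= #|` A| * height t)%N)) => //.
move=> B p l r _ _ /= lcost rcost.
rewrite mulnS -addnA leq_add2l -(card_children B p) mulnDl.
by apply: leq_add; [apply: leq_trans lcost _|apply: leq_trans rcost _];
  rewrite leq_mul2l (leq_maxl, leq_maxr) orbT.
Qed.

Lemma reached_leaf_supported n0 A q : (0 < n0)%N -> A != fset0 ->
  supported (fun t => (0 < #|` reached_leaf q t| <= n0)%N) (tree_law n0 A).
Proof.
move=> n0_gt0.
apply: (supported_tree_law
  (Q := fun _ t => 0 < #|` reached_leaf q t| <= n0)%N) => //.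
  by move=> B B0 Bn0 /=; rewrite cardfs_gt0 B0.
by move=> B p l r _ _ /= ? ?; case: ifP.
Qed.

Lemma search_result exh q t : (search exh q t).1 = (exh q (reached_leaf q t)).1.
Proof. by elim: t => //= A x1 x2 l IHl r IHr; case: ifP. Qed.

Lemma search_cost_le_height exh q t :
  ((search exh q t).2 <= height t + (exh q (reached_leaf q t)).2)%N.
Proof.
elim: t => //= A x1 x2 l IHl r IHr; rewrite addSn ltnS.
by case: ifP => _; [apply: leq_trans IHl _|apply: leq_trans IHr _];
  rewrite leq_add2r (leq_maxl, leq_maxr).
Qed.

Lemma generated_sub S A : generated S A -> A `<=` S.
Proof.
elim=> // [x y _ _|x y _ _|B C _ BS _ _].
- by apply/fsubsetP => z; rewrite !inE => /andP[].
- exact: fsubsetDl.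
- exact: fsubset_trans (fsubsetIl _ _) BS.
Qed.

(** Strong expansion is assumed only for generated sets, so the nodes of the tree have to be
    recognized as such. *)
Lemma generated_left S A p : generated S A -> p \in pivots A ->
  generated S (left_child A p).
Proof.
move=> SA /pivotsP[p1 p2 _]; have /fsubsetP AS := generated_sub SA.
rewrite (_ : left_child A p =
  A `&` [fset z in S | mdist z p.1 <= mdist z p.2]).
  by apply: generated_cap => //; apply: generated_half; exact: AS.
apply/fsetP => z; rewrite !inE; case: (boolP (z \in A)) => //= zA.
by rewrite AS.
Qed.

Lemma generated_right S A p : generated S A -> p \in pivots A ->
  generated S (right_child A p).
Proof.
move=> SA /pivotsP[p1 p2 _]; have /fsubsetP AS := generated_sub SA.
rewrite (_ : right_child A p =
  A `&` (S `\` [fset z in S | mdist z p.1 <= mdist z p.2])).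
  by apply: generated_cap => //; apply: generated_halfC; exact: AS.
apply/fsetP => z; rewrite !inE ltNge; case: (boolP (z \in A)) => //= zA.
by rewrite AS //= andbT.
Qed.

End Trees.

(** * Counting pairs through their fibers *)

Section Counting.

Lemma sumr_fset (R : pzSemiRingType) (T : choiceType) (D : {fset T})
    (P : pred T) :
  \sum_(x <- D) (P x)%:R = #|` [fset x in D | P x]|%:R :> R.
Proof.
have -> : #|` [fset x in D | P x]|%:R = \sum_(x <- [fset x in D | P x]) 1 :> R.
  by rewrite big_const_seq count_predT iter_addr_0.
rewrite big_fset [RHS]big_mkcond /=; apply: eq_bigr => x _.
by case: (P x).
Qed.

(** Abstracting the pairing as [g] lets either pivot index the fibers: it is [pair] for the left
    pivot and the swapped pairing for the right one. *)
Lemma card_fset_fibers (T U V : choiceType) (D : {fset V}) (A : {fset T})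
    (F : T -> {fset U}) (g : T -> U -> V) b :
  (forall v, v \in D -> exists x y, [/\ x \in A, y \in F x & v = g x y]) ->
  (forall x, x \in A -> (#|` F x| <= b)%N) -> (#|` D| <= #|` A| * b)%N.
Proof.
move=> DF Fb.
apply: (@leq_trans (size [seq g x y | x <- A, y <- F x])).
  by apply: uniq_leq_size => // v /DF ?; apply/allpairsPdep.
rewrite size_allpairs_dep.
have : {subset enum_fset A <= A} by [].
elim: (enum_fset A) => //= x s IH sA; rewrite mulSn leq_add ?Fb ?sA ?mem_head//.
by apply: IH => y ys; rewrite sA// inE ys orbT.
Qed.

End Counting.

(** * Balls and lopsided children in one random split *)

Section Splits.
Context {R : realType} {X : metricType R}.
Implicit Types (A S : {fset X}) (x : X) (p : X * X).

(** Every pair off the diagonal is a pair of pivots, and for |A| >= 2 the diagonal is at most half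
    of the square. *)
Lemma card_pivots A : (1 < #|` A|)%N -> (#|` A| * #|` A| <= 2 * #|` pivots A|)%N.
Proof.
move=> A1; suff : (#|` A| * #|` A| <= #|` pivots A| + #|` A|)%N by nia.
pose d := [seq (x, x) | x <- A].
rewrite -[X in (_ <= _ + X)%N](size_map (fun x => (x, x))) -size_cat.
rewrite -(size_allpairs pair); apply: uniq_leq_size.
  by apply: allpairs_uniq => // -[? ?] [? ?].
move=> _ /allpairsP[[x y] /= [xA yA ->]]; rewrite mem_cat.
have [->|xy] := eqVneq x y; first by rewrite map_f ?orbT.
by rewrite !inE /= xA yA xy.
Qed.

(* The ball reaching the farthest point y of the set on the left contains that
   whole set. *)
Lemma card_small_balls A x b :
  (#|` [fset y in A | (#|` ball_in A x (mdist x y)| <= b)%N]| <= b)%N.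
Proof.
set D := [fset y in A | _]; have [->|/fset0Pn[y0 y0D]] := eqVneq D fset0.
  by rewrite cardfs0.
have [y _ ymax] :=
  @arg_maxP _ _ D [` y0D] predT (fun y => mdist x (val y)) isT.
have := valP y; rewrite !inE => /andP[_]; apply: leq_trans.
apply: fsubset_leq_card; apply/fsubsetP => z zD.
have := zD; rewrite !inE => /andP[-> _] /=.
exact: (ymax [` zD]).
Qed.

(** With d the distance of the pivots, a point within d/4 of the left one is at least 3d/4 away from
    the right one. *)
Lemma ball_left_child A p : p \in pivots A ->
  ball_in A p.1 (mdist p.1 p.2 / 4) `<=` left_child A p.
Proof.
move=> /pivotsP[_ _ p12]; apply/fsubsetP => z; rewrite !inE => /andP[->] /=.
have := metric_triangle p.1 z p.2; rewrite (metric_sym z p.1).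
by have := mdist_ge0 p.1 p.2; lra.
Qed.

Lemma ball_right_child A p : p \in pivots A ->
  ball_in A p.2 (mdist p.1 p.2 / 4) `<=` right_child A p.
Proof.
move=> /pivotsP[_ _ p12]; apply/fsubsetP => z; rewrite !inE => /andP[->] /=.
have := metric_triangle p.1 z p.2.
rewrite (metric_sym z p.1) (metric_sym z p.2).
(* The right child is cut out by a strict inequality, so the pivots must be at positive distance. *)
have : 0 < mdist p.1 p.2 by rewrite mdist_gt0.
lra.
Qed.

Lemma expansion_quarter n0 S (c : R) A x r : 1 <= c ->
  strong_expansion n0 S c -> collection n0 S A -> x \in A -> 0 < r ->
  #|` ball_in A x r|%:R <= c ^+ 2 * #|` ball_in A x (r / 4)|%:R.
Proof.
move=> c1 exps SA xA r0.
have h2 : 0 < r / 2 by lra.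
have h4 : 0 < r / 4 by lra.
have := exps A x _ SA xA h2; have := exps A x _ SA xA h4.
have -> : 2 * (r / 2) = r by lra.
have -> : 2 * (r / 4) = r / 2 by lra.
move=> e4 e2; apply: le_trans e2 _.
by rewrite expr2 -mulrA ler_wpM2l//; lra.
Qed.

(* The threshold 1 / (16 c^2) gives each of the two children a probability of
   at most 1/8 of being lopsided. *)
Definition lopsided (c : R) A (B : {fset X}) : bool :=
  16 * c ^+ 2 * #|` B|%:R < #|` A|%:R.

(** The quarter ball lies in [B], and two doublings inflate it by at most c^2, while c^2 |B| < |A| /
    16. *)
Lemma lopsided_ball n0 S (c : R) A B x r : 1 <= c ->
  strong_expansion n0 S c -> collection n0 S A -> x \in A -> 0 < r ->
  ball_in A x (r / 4) `<=` B -> lopsided c A B ->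
  (#|` ball_in A x r| <= #|` A| %/ 16)%N.
Proof.
move=> c1 exps SA xA r0 rB; rewrite /lopsided => AB.
have qB : #|` ball_in A x (r / 4)|%:R <= #|` B|%:R :> R.
  by rewrite ler_nat fsubset_leq_card.
have := expansion_quarter c1 exps SA xA r0 => er.
have c2 : 0 <= c ^+ 2 by rewrite sqr_ge0.
have := ler_wpM2l c2 qB => eB.
have : (16 * #|` ball_in A x r|)%:R < #|` A|%:R :> R.
  by rewrite natrM; lra.
by rewrite ltr_nat; lia.
Qed.

Lemma card_lopsided_left n0 S (c : R) A : 1 <= c ->
  strong_expansion n0 S c -> collection n0 S A ->
  (#|` [fset p in pivots A | lopsided c A (left_child A p)]|
     <= #|` A| * (#|` A| %/ 16))%N.
Proof.
move=> c1 exps SA.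
apply: (card_fset_fibers (g := pair) (F := fun x =>
  [fset y in A | (#|` ball_in A x (mdist x y)| <= #|` A| %/ 16)%N])) => [p|x _];
  last exact: card_small_balls.
rewrite in_fset => /andP[/= pA lop].
have [p1 p2 p12] := pivotsP pA; exists p.1, p.2; split => //;
  last by case: p {pA lop p1 p2 p12}.
rewrite !inE p2 /=; apply: lopsided_ball exps SA p1 _ (ball_left_child pA) lop => //.
by rewrite mdist_gt0.
Qed.

Lemma card_lopsided_right n0 S (c : R) A : 1 <= c ->
  strong_expansion n0 S c -> collection n0 S A ->
  (#|` [fset p in pivots A | lopsided c A (right_child A p)]|
     <= #|` A| * (#|` A| %/ 16))%N.
Proof.
move=> c1 exps SA.
apply: (card_fset_fibers (g := fun y x => (x, y)) (F := fun y =>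
  [fset x in A | (#|` ball_in A y (mdist y x)| <= #|` A| %/ 16)%N])) => [p|x _];
  last exact: card_small_balls.
rewrite in_fset => /andP[/= pA lop].
have [p1 p2 p12] := pivotsP pA; exists p.2, p.1; split => //;
  last by case: p {pA lop p1 p2 p12}.
rewrite !inE p1 /= (metric_sym p.2).
apply: lopsided_ball exps SA p2 _ (ball_right_child pA) lop => //.
by rewrite mdist_gt0.
Qed.

(** * Contraction of powers of node sizes under a split *)

Lemma expRN3_le : expR (-3) <= 1 / 8 :> R.
Proof.
rewrite expRN div1r lef_pV2 ?posrE ?expR_gt0//.
have -> : 3 = 3%:R * 1 :> R by rewrite mulr1.
rewrite expRM_natl; have e2 : 2 <= expR 1 :> R by have := expR_ge1Dx (1 : R); lra.
have -> : 8 = 2 ^+ 3 :> R by ring.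
by apply: lerXn2r => //; rewrite nnegrE ?expR_ge0.
Qed.

(** Here [x] and [y] are the sizes of a child and its sibling. If the sibling is lopsided, only x <=
    m is used; otherwise x <= m (1 - 1/(16 c^2)) <= m exp(-1/(16 c^2)), and the exponent 48 c^2
    makes the factor exp(-3) <= 1/8. *)
Lemma powR_child (c x y m : R) : 1 <= c -> 0 <= x -> 0 <= y -> x + y = m ->
  x `^ (48 * c ^+ 2)
    <= m `^ (48 * c ^+ 2) * ((16 * c ^+ 2 * y < m)%R%:R + 1 / 8).
Proof.
move=> c1 x0 y0 xym; set a := 48 * c ^+ 2.
have c2 : 1 <= c ^+ 2 by rewrite exprn_ege1.
have a0 : 0 <= a by rewrite /a; lra.
have ma0 := powR_ge0 m a.
have xm : x <= m by lra.
case: ltP => /= [_|ym].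
  apply: le_trans (_ : m `^ a <= _); last by lra.
  by apply: ge0_ler_powR; rewrite ?nnegrE//; lra.
rewrite add0r; apply: le_trans (_ : (m * expR (- (16 * c ^+ 2)^-1)) `^ a <= _).
  apply: ge0_ler_powR => //; rewrite ?nnegrE ?mulr_ge0 ?expR_ge0//; first lra.
  apply: le_trans (_ : m * (1 - (16 * c ^+ 2)^-1) <= _); last first.
    by rewrite ler_wpM2l//; [lra|exact: expR_ge1Dx].
  have : m / (16 * c ^+ 2) <= y by rewrite ler_pdivrMr; lra.
  lra.
rewrite powRM ?expR_ge0//; last lra.
rewrite ler_wpM2l// -expRM.
have -> : - (16 * c ^+ 2)^-1 * a = - 3.
  by rewrite /a; field; rewrite lt0r_neq0//; lra.
exact: expRN3_le.
Qed.

(** On average the two lopsided indicators contribute at most 1/8 each and the constants 1/4, in all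
    1/2 <= exp(-1/2). *)
Lemma split_contraction n0 S (c : R) A : (0 < n0)%N -> 1 <= c ->
  strong_expansion n0 S c -> collection n0 S A ->
  \sum_(p <- pivots A) (#|` left_child A p|%:R `^ (48 * c ^+ 2)
      + #|` right_child A p|%:R `^ (48 * c ^+ 2))
    <= #|` pivots A|%:R * (#|` A|%:R `^ (48 * c ^+ 2) * expR (- 2^-1)).
Proof.
move=> n0_gt0 c1 exps SA; set a := 48 * c ^+ 2; set ma := #|` A|%:R `^ a.
apply: le_trans (_ : \sum_(p <- pivots A) ma *
  ((lopsided c A (left_child A p))%:R + (lopsided c A (right_child A p))%:R
   + 1 / 4) <= _).
  apply: ler_sum => p _.
  have lr : #|` left_child A p|%:R + #|` right_child A p|%:R = #|` A|%:R :> R.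
    by rewrite -natrD card_children.
  have := powR_child c1 (ler0n _ _) (ler0n _ _) lr.
  rewrite addrC in lr; have := powR_child c1 (ler0n _ _) (ler0n _ _) lr.
  by rewrite -/a -/ma /lopsided; lra.
rewrite -mulr_sumr !big_split /= !sumr_fset big_const_seq count_predT iter_addr_0.
have le2 : 2^-1 <= expR (- 2^-1) :> R.
  by apply: le_trans (expR_ge1Dx _); lra.
have A1 : (1 < #|` A|)%N by case: SA => _; apply: leq_ltn_trans.
have := card_lopsided_left c1 exps SA; have := card_lopsided_right c1 exps SA.
set dr := (X in (X <= _)%N) => hr; set dl := (X in (X <= _)%N) => hl.
have hp := card_pivots A1.
(* Each count is at most |A|^2 / 16, which by [hp] is at most an eighth of the pivot pairs. *)
have : ((dl + dr) * 4 <= #|` pivots A|)%N.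
  have : (#|` A| * (#|` A| %/ 16) * 16 <= #|` A| * #|` A|)%N.
    by rewrite -mulnA leq_mul2l leq_trunc_div orbT.
  lia.
rewrite -(ler_nat R) natrM natrD => d4.
rewrite [leRHS]mulrCA ler_wpM2l ?powR_ge0//.
apply: le_trans (_ : #|` pivots A|%:R * 2^-1 <= _).
  by rewrite -mulr_natr; lra.
by rewrite ler_wpM2l.
Qed.

(** * Tail of the tree height *)

(** Stated for all generated sets, so that the induction hypothesis applies to both children. *)
Lemma height_tail n0 S (c : R) A k : (0 < n0)%N -> 1 <= c ->
  strong_expansion n0 S c -> generated S A ->
  Prob (tree_law n0 A) (fun t => (k < height t)%N)
    <= expR (- 2^-1) ^+ k * (#|` A|%:R / n0%:R) `^ (48 * c ^+ 2).
Proof.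
move=> n0_gt0 c1 exps; set a := 48 * c ^+ 2.
have c2 : 1 <= c ^+ 2 by rewrite exprn_ege1.
have a0 : 0 <= a by rewrite /a; lra.
have w0 (B : {fset X}) : B != fset0 -> supported predT (tree_law n0 B).
  by apply: (supported_tree_law (Q := fun=> predT)).
elim: k A => [|k IH] A SA; have [An0|An0] := leqP #|` A| n0.
- rewrite tree_lawE An0 ProbE big_cons big_nil /= mulr0 addr0.
  by rewrite mul1r powR_ge0.
(* For k = 0 and |A| > n0 the right-hand side is at least 1. *)
- have A0 : A != fset0 by rewrite -cardfs_gt0 (ltn_trans _ An0).
  apply: le_trans (Prob_le1 _ (total_tree_law _ n0_gt0) (w0 A A0)) _.
  rewrite mul1r -[leLHS](congr1 (fun f => f a) (powR1 R)).
  apply: ge0_ler_powR => //; rewrite ?nnegrE ?divr_ge0//.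
  by rewrite ler_pdivlMr ?ltr0n// mul1r ler_nat ltnW.
- rewrite tree_lawE An0 ProbE big_cons big_nil /= mulr0 addr0.
  by rewrite mulr_ge0 ?powR_ge0// exprn_ge0 ?expR_ge0.
rewrite tree_lawE leqNgt An0 /= Prob_bind.
have piv0 : (0 < #|` pivots A|)%N.
  by rewrite cardfs_gt0 pivots_neq0//; apply: leq_ltn_trans An0.
(* The sum of the induction bounds for the two children, with the powers of their sizes isolated for
   [split_contraction]. *)
pose g p := expR (- 2^-1) ^+ k * n0%:R^-1 `^ a *
  (#|` left_child A p|%:R `^ a + #|` right_child A p|%:R `^ a).
apply: le_trans (_ : \sum_(wp <- law_unif R (pivots A)) wp.1 * g wp.2 <= _).
  apply: (ler_sum_supported (supported_unif _) (f := fun p => Prob (law_bind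
    (tree_law n0 (left_child A p)) (fun l => law_bind
    (tree_law n0 (right_child A p)) (fun r =>
    law_ret R (Node A p.1 p.2 l r)))) _) (g := g)) => p pA.
  have /andP[l0 _] := card_left_child pA; have /andP[r0 _] := card_right_child pA.
  rewrite cardfs_gt0 in l0; rewrite cardfs_gt0 in r0.
  apply: le_trans (Prob_bind2_le
    (E1 := fun l => (k < height l)%N) (E2 := fun r => (k < height r)%N)
    (total_tree_law _ n0_gt0) (total_tree_law _ n0_gt0) (w0 _ l0) (w0 _ r0) _) _.
    by move=> l r /=; rewrite ltnS leq_max.
  apply: le_trans
    (lerD (IH _ (generated_left SA pA)) (IH _ (generated_right SA pA))) _.
  by rewrite !powRM ?invr_ge0 ?ler0n// /g le_eqVlt; apply/orP; left; apply/eqP; ring.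
rewrite big_map /= -mulr_sumr -mulr_sumr ler_pdivrMl ?ltr0n//.
rewrite exprSr powRM ?invr_ge0 ?ler0n//.
have := split_contraction n0_gt0 c1 exps (conj SA An0); rewrite -/a.
have q0 : 0 <= expR (- 2^-1) ^+ k * n0%:R^-1 `^ a.
  by rewrite mulr_ge0 ?powR_ge0// exprn_ge0 ?expR_ge0.
move=> /(ler_wpM2l q0) /le_trans; apply.
by rewrite le_eqVlt; apply/orP; left; apply/eqP; ring.
Qed.

Lemma height_hstar n0 S (c eps : R) : (0 < n0)%N -> (n0 < #|` S|)%N -> 1 <= c ->
  strong_expansion n0 S c -> 0 < eps -> eps <= 1 ->
  Prob (tree_law n0 S) (fun t => hstar eps c #|` S| n0 < (height t)%:R) <= eps.
Proof.
move=> n0_gt0 n0S c1 exps eps0 eps1; set h := hstar _ _ _ _.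
have n0R : 0 < n0%:R :> R by rewrite ltr0n.
have Sn0 : 1 < #|` S|%:R / n0%:R :> R by rewrite ltr_pdivlMr// mul1r ltr_nat.
set L := ln (#|` S|%:R / n0%:R : R).
have L0 : 0 <= L by rewrite ln_ge0// ltW.
have le0 : ln eps <= 0 by rewrite ln_le0.
have hE : h = 3 * (1 - ln eps) + 96 * c ^+ 2 * L.
  by rewrite /h /hstar ln_div ?posrE ?expR_gt0// expRK.
have c2 : 0 <= c ^+ 2 by rewrite sqr_ge0.
have cL : 0 <= c ^+ 2 * L by rewrite mulr_ge0.
have h0 : 0 <= h by rewrite hE; lra.
(* Heights are integers, so exceeding h means exceeding its floor k, and k > h - 1. *)
have /andP[kh hk] := truncn_itv h0; set k := Num.truncn h in kh hk.
have -> : Prob (tree_law n0 S) (fun t => h < (height t)%:R) =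
          Prob (tree_law n0 S) (fun t => (k < height t)%N).
  rewrite !ProbE; apply: eq_bigr => wt _; congr (_ * _%:R).
  by rewrite /k truncn_lt_nat.
apply: le_trans (height_tail k n0_gt0 c1 exps (generated_full S)) _.
have -> : #|` S|%:R / n0%:R = expR L :> R by rewrite lnK// posrE (lt_trans _ Sn0).
(* From k > h - 1, the exponent -k/2 + 48 c^2 L is below -1 + (3/2) ln eps, hence below ln eps
   because ln eps <= 0. *)
rewrite -expRM -expRM_natl -expRD -[eps]lnK ?posrE// ler_expR.
rewrite -natr1 in hk; lra.
Qed.

End Splits.

(** * Comparison bounds for construction and search *)

Theorem corollary2 (R : realType) (X : metricType R) (S : {fset X})
    (n n0 : nat) (c eps : R)
    (card_S : #|` S| = n) (n0_ge1 : (1 <= n0)%N) (n0_lt_n : (n0 < n)%N)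
    (c_ge1 : 1 <= c) (S_expansion : strong_expansion n0 S c)
    (eps_gt0 : 0 < eps) :
  1 - eps <= Prob (tree_law n0 S)
    (fun t => (build_cost t)%:R <= n%:R * hstar eps c n n0)
  /\
  (forall (q : X) (exh : X -> {fset X} -> X * nat), exhaustive_search exh ->
    1 - eps <= Prob (tree_law n0 S)
      (fun t => ((search exh q t).2%:R <= hstar eps c n n0 + n0%:R)
                && nearest_in q (reached_leaf q t) (search exh q t).1)).
Proof.
subst n; have S0 : S != fset0 by rewrite -cardfs_gt0 (ltn_trans _ n0_lt_n).
have cost := build_cost_le_height n0_ge1 S0.
(* For eps > 1 both bounds are trivial, since 1 - eps is negative; [height_hstar] covers eps <=
   1. *)
have [eps1|/ltW eps1] := leP eps 1; last first.
  have eps0 : 1 - eps <= 0 by rewrite subr_le0.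
  by split=> [|q exh _]; apply: le_trans eps0 (Prob_ge0 _ cost).
have tail := height_hstar n0_ge1 n0_lt_n c_ge1 S_expansion eps_gt0 eps1.
have S1 := total_tree_law S n0_ge1.
split=> [|q exh exhP].
  apply: le_trans (Prob_ge_compl S1 cost _);
    first by rewrite lerD2l lerN2; exact: tail.
  move=> t /= tcost; rewrite -leNgt => th.
  apply: le_trans (_ : (#|` S| * height t)%:R <= _); first by rewrite ler_nat.
  by rewrite natrM ler_wpM2l.
(* The specification of [exh] speaks only of nonempty sets and bounds its cost by their size, so the
   leaf must be nonempty and have at most n0 elements. *)
have leaf := reached_leaf_supported q n0_ge1 S0.
apply: le_trans (Prob_ge_compl S1 leaf _);
    first by rewrite lerD2l lerN2; exact: tail.
move=> t /= /andP[leaf0 leafn0]; rewrite -leNgt => th.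
rewrite cardfs_gt0 in leaf0; have [near exhn] := exhP q _ leaf0.
rewrite search_result near andbT.
apply: le_trans (_ : (height t)%:R + n0%:R <= _); last by rewrite lerD2r.
rewrite -natrD ler_nat (leq_trans (search_cost_le_height _ _ _))//.
by rewrite leq_add2l (leq_trans exhn).
Qed.
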